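(* Let $X$ be a finite-dimensional Euclidean or Hermitian space and $M\in\bigwedge X$. Given a complement $V$ of $\lfloor M\rfloor$ in $X$ (i.e. $X=\lfloor M\rfloor\oplus V$), there is a unique (up to scalars) maximal tight blade factorization $M=B\wedge N$ with $N\in\bigwedge V$.
   Context: $X$ is a Euclidean (real) or Hermitian (complex) inner product space of finite dimension, with product $\langle\cdot,\cdot\rangle$ (conjugate-linear in the first argument in the complex case), and $\bigwedge X$ is its exterior algebra with the induced inner product (different grades orthogonal, $\langle x_1\wedge\cdots\wedge x_p,y_1\wedge\cdots\wedge y_p\rangle=\det(\langle x_i,y_j\rangle)$). The left contraction $M\lrcorner N$ is defined by $\langle L,M\lrcorner N\rangle=\langle M\wedge L,N\rangle$ for all $L$. A blade is a scalar or an exterior product of vectors; for a nonzero blade $B=v_1\wedge\cdots\wedge v_p$, $[B]=\mathrm{span}\{v_1,\ldots,v_p\}$, and $[\lambda]=\{0\}$ for a scalar $\lambda$. The inner and outer spaces of $M$ are $\lfloor M\rfloor=\{v\in X:v\wedge M=0\}$ and $\lceil M\rceil=\{v\in X:v\lrcorner M=0\}^\perp$. A blade factorization of $M$ is $M=B\wedge N$ with $B\neq0$ a blade and $N\in\bigwedge X$. It is tight if $\lceil N\rceil\cap[B]=\{0\}$, and maximal if $[B]=\lfloor M\rfloor$. Unique up to scalars means that any two such factorizations $B\wedge N=B'\wedge N'$ satisfy $B'=\lambda B$ and $N'=\lambda^{-1}N$ for some scalar $\lambda\ne0$. *)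

(* Defs.v *)
From HB Require Import structures.
From mathcomp Require Import all_boot all_order all_algebra falgebra.
From mathcomp Require Import reals complex.
From mathcomp Require classical_sets.

Set Implicit Arguments.
Unset Strict Implicit.
Unset Printing Implicit Defensive.
Import Order.TTheory GRing.Theory Num.Theory.
Local Open Scope ring_scope.

Section Inversions.
Variable n : nat.
Implicit Types A B C : {set 'I_n}.

Definition inversions A B : nat := (\sum_(i in A) \sum_(j in B) (j < i))%N.

Lemma inversions0l A : inversions set0 A = 0%N.
Proof. by rewrite /inversions big_set0. Qed.

Lemma inversions0r A : inversions A set0 = 0%N.
Proof. by rewrite /inversions big1 // => i _; rewrite big_set0. Qed.

Lemma inversionsUl A B C : [disjoint A & B] ->
  inversions (A :|: B) C = (inversions A C + inversions B C)%N.
Proof.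
move=> dAB; rewrite /inversions -bigU //=; apply: eq_bigl => i.
by rewrite !inE.
Qed.

Lemma inversionsUr A B C : [disjoint B & C] ->
  inversions A (B :|: C) = (inversions A B + inversions A C)%N.
Proof.
move=> dBC; rewrite /inversions -big_split /=; apply: eq_bigr => i _.
rewrite -bigU //=; apply: eq_bigl => j; by rewrite !inE.
Qed.

End Inversions.

(* An element of the exterior algebra is given by its coordinates on the basis
   e_A = e_(i_1) /\ ... /\ e_(i_p), A = {i_1 < ... < i_p}, where e is the basis
   [vbasis fullv] of X. The exterior product is the ring product [*]; [vec_sq]
   and [ext_prod_basis] show that this is the exterior algebra of X. *)
Definition exterior (K : fieldType) (X : vectType K) : predArgType :=
  {ffun {set 'I_(\dim {:X})} -> K^o}.

HB.instance Definition _ (K : fieldType) (X : vectType K) :=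
  Vector.on (exterior X).

Section Algebra.
Variables (K : fieldType) (X : vectType K).
Local Notation n := (\dim {:X}).
Local Notation E := (exterior X).
Implicit Types (A B C D : {set 'I_n}) (M N P : E).

(* e_A /\ e_B = (-1)^(inversions A B) e_(A u B) when A and B are disjoint,
   and 0 otherwise *)
Definition wedge M N : E :=
  [ffun C : {set 'I_n} => \sum_(A : {set 'I_n} | A \subset C)
     (-1) ^+ inversions A (C :\: A) * M A * N (C :\: A) : K^o].

Definition ext1 : E := [ffun A => (A == set0)%:R].

Lemma wedgeA : associative wedge.
Proof.
move=> M N P; apply/ffunP => D; rewrite !ffunE.
under [RHS]eq_bigr => C _ do rewrite ffunE mulr_sumr mulr_suml.
rewrite [RHS](exchange_big_dep (fun A => A \subset D)) /=; last first.
  by move=> C A CD AC; apply: subset_trans CD.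
apply: eq_bigr => A AD; rewrite ffunE mulr_sumr.
rewrite [RHS](reindex_onto (fun B => A :|: B) (fun C => C :\: A)) /=; last first.
  move=> C /andP[_ AC]; apply/setP => x; rewrite !inE.
  by case: (boolP (x \in A)) => //= /(subsetP AC) ->.
have disj B : B \subset D :\: A -> [disjoint A & B].
  by rewrite subsetD disjoint_sym => /andP[].
have ABK B : [disjoint A & B] -> (A :|: B) :\: A = B.
  move=> dAB; apply/setP => x; rewrite !inE.
  case: (boolP (x \in A)) => //= xA.
  by rewrite (disjointFr dAB xA).
apply: eq_big => [B|B BDA].
  rewrite subUset AD subsetUl andbT /= subsetD; congr (_ && _).
  apply/idP/eqP => [|<-]; first by rewrite disjoint_sym => /ABK.
  by rewrite disjoint_sym -setI_eq0 setDE setIC -setIA (setIC _ A) setICr setI0.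
rewrite (ABK _ (disj _ BDA)) -setDDl.
set F := (D :\: A) :\: B.
have DA : D :\: A = B :|: F.
  rewrite /F; apply/setP => x; move/subsetP/(_ x): BDA; rewrite !inE.
  by case: (x \in B) => //= ->.
have dBF : [disjoint B & F] by rewrite -setI_eq0 /F setDE setICA setICr setI0.
rewrite {1}DA (inversionsUr _ dBF) (inversionsUl _ (disj _ BDA)) !exprD.
rewrite !mulrA; congr (_ * _).
rewrite (mulrAC _ (M A)) (mulrC (_ ^+ inversions A B)).
by rewrite (mulrAC _ (_ ^+ inversions A B)).
Qed.

Lemma wedge1l : left_id ext1 wedge.
Proof.
move=> M; apply/ffunP => C; rewrite ffunE (bigD1 set0) ?sub0set //=.
rewrite big1 => [|A /andP[_ /negPf A0]]; last by rewrite ffunE A0 mulr0 mul0r.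
by rewrite ffunE eqxx inversions0l setD0 mulr1 mul1r addr0.
Qed.

Lemma wedge1r : right_id ext1 wedge.
Proof.
move=> M; apply/ffunP => C; rewrite ffunE (bigD1 C) //=.
rewrite big1 => [|A /andP[AC ANC]].
  by rewrite ffunE setDv eqxx inversions0r mulr1 mul1r addr0.
rewrite ffunE setD_eq0 (negPf (_ : ~~ (C \subset A))) ?mulr0 //.
by apply: contra ANC => CA; rewrite eqEsubset AC.
Qed.

Lemma wedgeDl : left_distributive wedge +%R.
Proof.
move=> M N P; apply/ffunP => C; rewrite !ffunE -big_split /=.
by apply: eq_bigr => A _; rewrite ffunE mulrDr mulrDl.
Qed.

Lemma wedgeDr : right_distributive wedge +%R.
Proof.
move=> M N P; apply/ffunP => C; rewrite !ffunE -big_split /=.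
by apply: eq_bigr => A _; rewrite ffunE mulrDr.
Qed.

Lemma ext1_neq0 : ext1 != 0.
Proof. by apply/eqP => /ffunP/(_ set0)/eqP; rewrite !ffunE eqxx oner_eq0. Qed.

HB.instance Definition _ := GRing.Zmodule_isNzRing.Build E
  wedgeA wedge1l wedge1r wedgeDl wedgeDr ext1_neq0.

Lemma wedgeZl (a : K) M N : a *: (M * N) = a *: M * N.
Proof.
apply/ffunP => C; rewrite !ffunE /GRing.scale /= mulr_sumr.
by apply: eq_bigr => A _; rewrite ffunE /GRing.scale /= !mulrA (mulrC a).
Qed.

HB.instance Definition _ := GRing.Lmodule_isLalgebra.Build K E wedgeZl.

Lemma wedgeZr (a : K) M N : a *: (M * N) = M * (a *: N).
Proof.
apply/ffunP => C; rewrite !ffunE /GRing.scale /= mulr_sumr.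
by apply: eq_bigr => A _; rewrite ffunE /GRing.scale /= mulrCA.
Qed.

HB.instance Definition _ := GRing.Lalgebra_isAlgebra.Build K E wedgeZr.
HB.instance Definition _ := Algebra_isFalgebra.Build K E.

End Algebra.

Section Vectors.
Variables (K : fieldType) (X : vectType K).
Local Notation n := (\dim {:X}).
Local Notation E := (exterior X).
Local Notation b := (vbasis {:X}).
Implicit Types (A B C : {set 'I_n}) (M N : E) (u v : X) (s t : seq X).

Definition ext_basis A : E := [ffun B => (A == B)%:R].

(* the inclusion of X in its exterior algebra *)
Definition vec v : E := \sum_i coord b i v *: ext_basis [set i].

Lemma vec_is_linear : linear vec.
Proof.
move=> a u v; rewrite /vec scaler_sumr -big_split /=; apply: eq_bigr => i _.
by rewrite linearP scalerDl scalerA.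
Qed.

HB.instance Definition _ := GRing.isLinear.Build K X E *:%R vec vec_is_linear.

Lemma ext_basis_sum M : M = \sum_A M A *: ext_basis A.
Proof.
apply/ffunP => B; rewrite sum_ffunE (bigD1 B) //= big1 => [|A /negPf AB].
  by rewrite !ffunE eqxx addr0 /GRing.scale /= mulr1.
by rewrite !ffunE AB scaler0.
Qed.

Lemma ext_basis0 : ext_basis set0 = 1.
Proof. by apply/ffunP => A; rewrite !ffunE eq_sym. Qed.

Lemma ext_basisM A B : ext_basis A * ext_basis B =
  if [disjoint A & B] then (-1) ^+ inversions A B *: ext_basis (A :|: B) else 0.
Proof.
have -> : ext_basis A * ext_basis B = wedge (ext_basis A) (ext_basis B) by [].
apply/ffunP => C; rewrite ffunE.
have [AC|/negP nAC] := boolP (A \subset C); last first.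
  rewrite big1 => [|A' A'C]; last first.
    rewrite [ext_basis A A']ffunE; case: eqP => [AA'|_]; last by rewrite mulr0 mul0r.
    by case: nAC; rewrite AA'.
  case: ifP => _; rewrite !ffunE //; case: eqP => [ABC|_]; last by rewrite scaler0.
  by case: nAC; rewrite -ABC subsetUl.
rewrite (bigD1 A) //= big1 => [|A' /andP[_ /negPf A'A]]; last first.
  by rewrite [ext_basis A A']ffunE eq_sym A'A mulr0 mul0r.
rewrite addr0 !ffunE eqxx mulr1.
have [BE|nBE] := eqVneq B (C :\: A).
  have dAB : [disjoint A & B] by rewrite BE -setI_eq0 setDE setICA setICr setI0.
  have CE : A :|: B = C by rewrite BE -{2}(setID C A) (setIidPr AC).
  by rewrite dAB !ffunE CE BE !eqxx.
rewrite mulr0; case: ifP => dAB; rewrite !ffunE //.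
case: eqP => [ABC|_]; last by rewrite scaler0.
case/eqP: nBE; apply/setP => x; rewrite -ABC !inE.
by case: (boolP (x \in A)) => //= xA; rewrite (disjointFr dAB xA).
Qed.

Lemma vec_basis (i : 'I_n) : vec b`_i = ext_basis [set i].
Proof.
rewrite /vec (bigD1 i) //= big1 => [|j /negPf ji].
  by rewrite coord_free ?(basis_free (vbasisP _)) // eqxx scale1r addr0.
by rewrite coord_free ?(basis_free (vbasisP _)) // eq_sym ji scale0r.
Qed.

Lemma vecC u v : vec u * vec v = - (vec v * vec u).
Proof.
rewrite /vec !mulr_suml -sumrN.
under eq_bigr do rewrite mulr_sumr.
under [RHS]eq_bigr do rewrite mulr_sumr -sumrN.
rewrite exchange_big; apply: eq_bigr => i _; apply: eq_bigr => j _.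
rewrite -!scalerAl -!scalerAr !scalerA mulrC -scalerN; congr (_ *: _).
rewrite !ext_basisM !disjoints1 !inE (eq_sym i j).
have [_|ji] := eqVneq j i; first by rewrite oppr0.
rewrite /inversions !big_set1 setUC -scaleNr; congr (_ *: _).
case: (ltngtP j i) ji => //=; rewrite ?expr1 ?expr0 ?opprK //.
by move=> /val_inj ->; rewrite eqxx.
Qed.

Lemma vec_sq v : vec v * vec v = 0.
Proof.
rewrite {1}/vec mulr_suml.
have sq (i : 'I_n) : vec b`_i * vec b`_i = 0.
  by rewrite vec_basis ext_basisM disjoints1 inE eqxx.
rewrite /vec.
under eq_bigr do rewrite mulr_sumr.
under eq_bigr do under eq_bigr do rewrite -!vec_basis -scalerAl -scalerAr scalerA.
rewrite pair_big /= (bigID (fun p : 'I_n * 'I_n => (p.1 < p.2)%N)) /=.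
rewrite [X in _ + X](bigID (fun p : 'I_n * 'I_n => (p.2 < p.1)%N)) /=.
rewrite [X in _ + (_ + X)]big1 ?addr0 => [|[i j]]; last first.
  rewrite /= -!leqNgt -eqn_leq => /eqP /val_inj ->.
  by rewrite sq scaler0.
have swapK : involutive (fun p : 'I_n * 'I_n => (p.2, p.1)) by case.
rewrite [X in _ + X](reindex_inj (inv_inj swapK)) /=.
rewrite [X in _ + X](eq_bigl (fun p : 'I_n * 'I_n => (p.1 < p.2)%N)); last first.
  by move=> [i j] /=; case: ltngtP.
rewrite -big_split big1 //= => -[i j] _ /=.
by rewrite (vecC b`_j) scalerN (mulrC (coord b j v)) subrr.
Qed.

Definition ext_prod s : E := \prod_(v <- s) vec v.

Lemma ext_prod_basis A : ext_prod [seq b`_i | i : 'I_n <- enum A] = ext_basis A.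
Proof.
rewrite /ext_prod big_map.
have: sorted (fun i j : 'I_n => (i < j)%N) (enum A).
  rewrite {1}/enum_mem -enumT; apply: sorted_filter.
    by move=> i j k; apply: ltn_trans.
  by have := iota_ltn_sorted 0 n; rewrite -val_enum_ord sorted_map.
have -> : ext_basis A = ext_basis [set i in enum A].
  by congr ext_basis; apply/setP => i; rewrite inE mem_enum.
elim: (enum A) => [_|i s IHs].
  by rewrite big_nil -ext_basis0; congr ext_basis; apply/setP => j; rewrite !inE.
rewrite /= path_sortedE => [/andP[/allP lt_i /IHs prod_s]|]; last first.
  by move=> ? ? ?; apply: ltn_trans.
rewrite big_cons prod_s vec_basis ext_basisM disjoints1 inE.
case: ifPn => [i_s|]; last by rewrite negbK => /lt_i; rewrite ltnn.
rewrite /inversions big_set1 big1 => [|j]; last first.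
  by rewrite inE => /lt_i ij; rewrite ltnNge ltnW.
by rewrite expr0 scale1r; congr ext_basis; apply/setP => j; rewrite !inE.
Qed.

(* An alternating multilinear form is determined by its values on the increasing
   sequences of vectors of b. *)
Lemma alternating_eq0 (phi : seq X -> K) :
    (forall s t a u v, phi (s ++ (a *: u + v) :: t) =
       a * phi (s ++ u :: t) + phi (s ++ v :: t)) ->
    (forall s t u, phi (s ++ [:: u, u & t]) = 0) ->
    (forall A, phi [seq b`_i | i : 'I_n <- enum A] = 0) ->
  forall s, phi s = 0.
Proof.
move=> phiL phi_alt phi_b.
have phiD s t u v : phi (s ++ (u + v) :: t) = phi (s ++ u :: t) + phi (s ++ v :: t).
  by rewrite -[u]scale1r phiL scale1r mul1r.
have phi0 s t : phi (s ++ 0 :: t) = 0.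
  by have := phiL s t (-1) 0 0; rewrite scaler0 addr0 mulN1r addNr.
have swap s t u v : phi (s ++ [:: u, v & t]) = 0 -> phi (s ++ [:: v, u & t]) = 0.
  move=> uv0; have := phi_alt s t (u + v).
  rewrite phiD -(cat_rcons u s) -(cat_rcons v s) !phiD !cat_rcons !phi_alt uv0.
  rewrite add0r addr0 => vu0.
  by rewrite -[RHS]vu0 add0r.
have move1 s1 s2 s3 u : phi (s1 ++ u :: s2 ++ s3) = 0 -> phi (s1 ++ s2 ++ u :: s3) = 0.
  elim: s2 s1 => [|v s2 IH] s1 //= /swap.
  by rewrite -!(cat_rcons v s1) => /IH.
have block s1 s2 s3 : phi (s1 ++ s2 ++ s3) = 0 -> phi (s2 ++ s1 ++ s3) = 0.
  elim/last_ind: s1 s3 => [|s1 u IH] s3 //; rewrite !cat_rcons.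
  by move=> /move1 /IH.
have permP s t : perm_eq s t -> phi s = 0 -> phi t = 0.
  exact: (catCA_perm_ind (P := fun s => phi s = 0)).
have phi_map (l : seq 'I_n) : phi [seq b`_i | i : 'I_n <- l] = 0.
  have [Ul|nUl] := boolP (uniq l).
    apply: permP (phi_b [set i in l]); apply: perm_map.
    by apply: uniq_perm; rewrite ?enum_uniq // => i; rewrite mem_enum inE.
  have [i [l' ll']] : exists i l', perm_eq [:: i, i & l'] l.
    elim: l nUl => //= i l IH; rewrite negb_and negbK => /orP[il|/IH[j [l' ll']]].
      by exists i, (rem i l); rewrite perm_cons perm_sym perm_to_rem.
    exists j, (i :: l'); rewrite (perm_catCA [:: j; j] [:: i]) /=.
    by rewrite perm_cons.
  by apply: permP (perm_map _ ll') _; apply: (phi_alt [::]).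
suff gen s : forall l : seq 'I_n, phi ([seq b`_i | i : 'I_n <- l] ++ s) = 0.
  by move=> s; apply: (gen s [::]).
elim: s => [|v s IH] l; first by rewrite cats0.
rewrite (coord_vbasis (memvf v)).
elim/big_ind: _ => [||i _]; first exact: phi0.
  by move=> y z y0 z0; rewrite phiD y0 z0 addr0.
rewrite -[_ *: _]addr0 phiL phi0 addr0 -cat_rcons -map_rcons IH.
by rewrite mulr0.
Qed.

Lemma ext_prod_dup s v : v \in s -> vec v * ext_prod s = 0.
Proof.
rewrite /ext_prod; elim: s => //= u s IHs; rewrite inE big_cons mulrA.
case: eqP => [->|_ /= /IHs vs0]; first by rewrite vec_sq mul0r.
by rewrite vecC mulNr -mulrA vs0 mulr0 oppr0.
Qed.

Lemma ext_prod_span s v : v \in <<s>>%VS -> vec v * ext_prod s = 0.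
Proof.
move=> /(@coord_span _ _ _ (in_tuple s)) ->; rewrite linear_sum mulr_suml big1 // => i _.
by rewrite linearZ /= -scalerAl ext_prod_dup ?scaler0 // mem_nth.
Qed.

Lemma ext_prod_neq0_free s : ext_prod s != 0 -> free s.
Proof.
elim: s => [|v s IHs]; first by rewrite nil_free.
rewrite free_cons /ext_prod big_cons => nz; apply/andP; split.
  by apply: contraNN nz => /ext_prod_span ->.
by apply: IHs; apply: contraNneq nz => /= ps0; rewrite -/(ext_prod s) ps0 mulr0.
Qed.

End Vectors.

(* MathComp forms are linear in the first argument and theta-linear in the
   second one, so that <x, y>, conjugate-linear in x, is [g y x]. *)
Section InnerProduct.
Variables (K : numFieldType) (theta : involutive_rmorphism K) (X : vectType K).
Variable g : {dot X for theta}.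
Local Notation n := (\dim {:X}).
Local Notation E := (exterior X).
Local Notation b := (vbasis {:X}).
Implicit Types (A B C : {set 'I_n}) (L M N P : E) (u v : X) (s t : seq X).

Definition gram s t : 'M[K]_(size s) := \matrix_(i, j) g t`_j s`_i.

(* <x_1 /\ ... /\ x_p, y_1 /\ ... /\ y_q> for s = x_1, ..., x_p and
   t = y_1, ..., y_q; see [ext_dot_prod] *)
Definition gram_det s t : K := if size s == size t then \det (gram s t) else 0.

Definition basis_of_set A : seq X := [seq b`_i | i : 'I_n <- enum A].

Definition ext_dot M N : K :=
  \sum_A \sum_B theta (M A) * N B * gram_det (basis_of_set A) (basis_of_set B).

Lemma gram_detC s t : gram_det s t = theta (gram_det t s).
Proof.
rewrite /gram_det eq_sym; case: ifP => [/eqP st|_]; last by rewrite rmorph0.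
rewrite -det_map_mx -det_tr.
have -> : gram s t = castmx (st, st) (map_mx theta (gram t s))^T.
  by apply/matrixP => i j; rewrite castmxE !mxE (hermC g) mul1r.
move: (map_mx _ _) => G; move: (size s) st => m st.
by case: m / st; rewrite castmx_id trmxK.
Qed.

Lemma gram_detP s t1 t2 a u v : gram_det s (t1 ++ (a *: u + v) :: t2) =
  a * gram_det s (t1 ++ u :: t2) + gram_det s (t1 ++ v :: t2).
Proof.
rewrite /gram_det !size_cat /=; case: ifP => [/eqP sz|_]; last by rewrite mulr0 addr0.
have k_lt : (size t1 < size s)%N by rewrite sz -addSnnS leq_addr.
rewrite -det_tr -(det_tr (gram s (t1 ++ u :: t2))) -(det_tr (gram s (t1 ++ v :: t2))).
rewrite -[X in _ = _ + X]mul1r.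
apply: (determinant_multilinear (i0 := Ordinal k_lt)).
- apply/rowP => i; rewrite !mxE !nth_cat ltnn subnn /=.
  by rewrite linearPl mul1r.
- apply/matrixP => i j; rewrite !mxE !nth_cat.
  case: ltngtP (neq_lift (Ordinal k_lt) i) => //=.
  + by move=> h _; rewrite -(subnSK h).
  + by move=> h /eqP[]; apply/val_inj.
- apply/matrixP => i j; rewrite !mxE !nth_cat.
  case: ltngtP (neq_lift (Ordinal k_lt) i) => //=.
  + by move=> h _; rewrite -(subnSK h).
  + by move=> h /eqP[]; apply/val_inj.
Qed.

Lemma gram_det_alt s t1 t2 u : gram_det s (t1 ++ [:: u, u & t2]) = 0.
Proof.
rewrite /gram_det !size_cat /=; case: ifP => // /eqP sz.
have k1_lt : (size t1 < size s)%N by rewrite sz -addSnnS leq_addr.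
have k2_lt : ((size t1).+1 < size s)%N by rewrite sz -!addSnnS leq_addr.
rewrite -det_tr (@determinant_alternate _ _ _ (Ordinal k1_lt) (Ordinal k2_lt)) //.
  by rewrite -val_eqE /= neq_ltn ltnSn.
by move=> i; rewrite !mxE !nth_cat ltnn subnn ltnNge leqnSn subSnn.
Qed.

Lemma ext_dotC M N : ext_dot M N = theta (ext_dot N M).
Proof.
rewrite /ext_dot rmorph_sum exchange_big; apply: eq_bigr => A _.
rewrite rmorph_sum; apply: eq_bigr => B _.
by rewrite !rmorphM /= rmorphK -gram_detC (mulrC (N A)).
Qed.

Lemma ext_dotPr L a M N : ext_dot L (a *: M + N) = a * ext_dot L M + ext_dot L N.
Proof.
rewrite /ext_dot mulr_sumr -big_split; apply: eq_bigr => A _ /=.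
rewrite mulr_sumr -big_split; apply: eq_bigr => B _ /=.
by rewrite !ffunE mulrDr mulrDl /GRing.scale /= mulrCA !mulrA.
Qed.

Lemma ext_dotPl L a M N :
  ext_dot (a *: M + N) L = theta a * ext_dot M L + ext_dot N L.
Proof. by rewrite ext_dotC ext_dotPr rmorphD rmorphM /= -!ext_dotC. Qed.

HB.instance Definition _ L := GRing.isLinear.Build K E K *%R (ext_dot L)
  (fun a M N => ext_dotPr L a M N).

Lemma ext_dot_basis A B :
  ext_dot (ext_basis A) (ext_basis B) = gram_det (basis_of_set A) (basis_of_set B).
Proof.
rewrite /ext_dot (bigD1 A) //= [X in _ + X]big1 => [|A' /negPf A'A]; last first.
  by rewrite big1 // => B' _; rewrite !ffunE eq_sym A'A rmorph0 !mul0r.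
rewrite (bigD1 B) //= big1 => [|B' /negPf B'B].
  by rewrite !ffunE !eqxx rmorph1 !mul1r !addr0.
by rewrite [ext_basis B B']ffunE eq_sym B'B mulr0 mul0r.
Qed.

(* the defining property of the inner product on the exterior algebra *)
Lemma ext_dot_prod s t : ext_dot (ext_prod s) (ext_prod t) = gram_det s t.
Proof.
have basis_prod A t' :
    ext_dot (ext_basis A) (ext_prod t') = gram_det (basis_of_set A) t'.
  apply/eqP; rewrite -subr_eq0; apply/eqP.
  apply: (alternating_eq0 (phi := fun t =>
    ext_dot (ext_basis A) (ext_prod t) - gram_det (basis_of_set A) t)).
  - move=> s1 s2 a u v; rewrite gram_detP.
    rewrite /ext_prod !big_cat !big_cons /= linearP /= mulrDl mulrDr.
    by rewrite -scalerAl -scalerAr ext_dotPr mulrBr opprD addrACA.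
  - move=> s1 s2 u; rewrite gram_det_alt subr0 /ext_prod big_cat !big_cons /=.
    by rewrite (mulrA (vec u)) vec_sq mul0r mulr0 linear0.
  - by move=> B; rewrite ext_prod_basis ext_dot_basis subrr.
apply/eqP; rewrite -subr_eq0 ext_dotC gram_detC -rmorphB fmorph_eq0; apply/eqP.
apply: (alternating_eq0 (phi := fun s =>
  ext_dot (ext_prod t) (ext_prod s) - gram_det t s)).
- move=> s1 s2 a u v; rewrite gram_detP.
  rewrite /ext_prod !big_cat !big_cons /= linearP /= mulrDl mulrDr.
  by rewrite -scalerAl -scalerAr ext_dotPr mulrBr opprD addrACA.
- move=> s1 s2 u; rewrite gram_det_alt subr0 /ext_prod big_cat !big_cons /=.
  by rewrite (mulrA (vec u)) vec_sq mul0r mulr0 linear0.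
by move=> B; rewrite ext_prod_basis ext_dotC basis_prod -gram_detC subrr.
Qed.

Lemma dot_eq0 u : g u u = 0 -> u = 0.
Proof.
move=> uu0; apply/eqP; apply: contraT => /(@neq0_dnorm_gt0 _ _ _ g).
by rewrite uu0 ltxx.
Qed.

Lemma gram_free s : free s -> \det (gram s s) != 0.
Proof.
move=> free_s; apply/det0P => -[c c0 cG]; case/negP: c0; apply/eqP.
pose w := \sum_(i < size s) theta (c 0 i) *: s`_i.
have sw (j : 'I_(size s)) : g s`_j w = 0.
  have /rowP/(_ j) := cG; rewrite !mxE => cj.
  rewrite -[RHS]cj /w linear_sumr; apply: eq_bigr => i _.
  by rewrite linearZr_LR /= rmorphK mxE.
have w0 : w = 0.
  apply: dot_eq0; rewrite {1}/w linear_sumlz big1 // => i _.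
  by rewrite linearZl_LR /= sw mulr0.
have c0 := elimT (@freeP _ _ _ (in_tuple s)) free_s (fun i => theta (c 0 i)) w0.
by apply/rowP => i; have /eqP := c0 i; rewrite fmorph_eq0 mxE => /eqP.
Qed.

Lemma ext_prod_free s : free s -> ext_prod s != 0.
Proof.
move=> /gram_free; apply: contraNneq => s0.
have <- : gram_det s s = \det (gram s s) by rewrite /gram_det eqxx.
by rewrite -ext_dot_prod s0 linear0.
Qed.

End InnerProduct.

Section Contraction.
Variables (K : numFieldType) (theta : involutive_rmorphism K) (X : vectType K).
Variable g : {dot X for theta}.
Local Notation n := (\dim {:X}).
Local Notation E := (exterior X).
Local Notation b := (vbasis {:X}).
Implicit Types (A B C : {set 'I_n}) (L M N P : E) (u v : X) (s t : seq X).

Lemma dual_basis : exists h : 'I_n -> X, forall i j : 'I_n, g b`_j (h i) = (i == j)%:R.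
Proof.
pose G : 'M[K]_n := \matrix_(i, j) g b`_j b`_i.
have Gunit : G \in unitmx.
  have /(gram_free g) : free b by apply: basis_free (vbasisP _).
  have -> : gram g b b = castmx (esym (size_tuple b), esym (size_tuple b)) G.
    by apply/matrixP => i j; rewrite castmxE !mxE.
  move: G (esym _) => G e; rewrite unitmxE unitfE.
  by move: (size b) e => m e; case: m / e; rewrite castmx_id.
exists (fun i => \sum_k theta (invmx G i k) *: b`_k) => i j.
have /matrixP/(_ i j) := mulVmx Gunit; rewrite !mxE => <-.
rewrite linear_sumr; apply: eq_bigr => k _.
by rewrite linearZr_LR /= rmorphK mxE.
Qed.

Lemma ext_dual_basis :
  exists H : {set 'I_n} -> E, forall A B, ext_dot g (H A) (ext_basis B) = (A == B)%:R.
Proof.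
have [h hb] := dual_basis.
exists (fun A => ext_prod [seq h i | i <- enum A]) => A B.
rewrite -(ext_prod_basis B) ext_dot_prod.
have [<-|neqAB] := eqVneq A B.
  rewrite /gram_det ifT ?size_map //.
  have := enum_uniq A; move: (enum A) => a Ua.
  suff -> : gram g [seq h i | i <- a] [seq b`_i | i : 'I_n <- a] = 1%:M by rewrite det1.
  apply/matrixP => i j; rewrite !mxE.
  have ia : (i < size a)%N by rewrite -(size_map h) ltn_ord.
  have ja : (j < size a)%N by rewrite -(size_map h) ltn_ord.
  case: a i j ia ja Ua => [|i0 a] i j //; set a' := i0 :: a => ia ja Ua.
  by rewrite !(nth_map i0) // hb nth_uniq.
rewrite /gram_det; case: ifP => // /eqP AB0.
have AB : #|A| = #|B| by move: AB0; rewrite !size_map -!cardE.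
have [x xA xB] : exists2 x, x \in A & x \notin B.
  by apply/subsetPn; apply: contraNN neqAB => sAB; rewrite eqEcard sAB AB leqnn.
have x_lt : (index x (enum A) < size [seq h i | i <- enum A])%N.
  by rewrite size_map index_mem mem_enum.
rewrite (expand_det_row _ (Ordinal x_lt)) big1 // => j _; rewrite mxE /=.
have jB : (j < size (enum B))%N.
  by rewrite -cardE -AB cardE -(size_map h) ltn_ord.
rewrite !(nth_map x) ?index_mem ?mem_enum // hb nth_index ?mem_enum //.
case: eqP => [xE|_]; last by rewrite mul0r.
by case/negP: xB; rewrite xE -mem_enum mem_nth.
Qed.

Lemma ext_dot_sumr L I (r : seq I) (F : I -> E) :
  ext_dot g L (\sum_(i <- r) F i) = \sum_(i <- r) ext_dot g L (F i).
Proof. exact: linear_sum. Qed.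

Lemma ext_dotZr L a M : ext_dot g L (a *: M) = a * ext_dot g L M.
Proof. exact: linearZ. Qed.

Lemma ext_dot_nondegenerate P : (forall L, ext_dot g L P = 0) -> P = 0.
Proof.
have [H HE] := ext_dual_basis; move=> P0; apply/ffunP => A; rewrite ffunE.
rewrite -[RHS](P0 (H A)) [in RHS](ext_basis_sum P) ext_dot_sumr (bigD1 A) //=.
rewrite big1 => [|B /negPf BA]; rewrite ext_dotZr HE ?eqxx ?mulr1 ?addr0 //.
by rewrite eq_sym BA mulr0.
Qed.

Lemma ext_dot_riesz (f : E -> K) :
    (forall a L M, f (a *: L + M) = theta a * f L + f M) ->
  exists P, forall L, ext_dot g L P = f L.
Proof.
have [H HE] := ext_dual_basis; move=> f_lin.
have f0 : f 0 = 0.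
  by have := f_lin (-1) 0 0; rewrite scaler0 addr0 rmorphN1 mulN1r addNr.
exists (\sum_A f (H A) *: ext_basis A) => L.
have LE : L = \sum_A ext_dot g (ext_basis A) L *: H A.
  apply/eqP; rewrite -subr_eq0; apply/eqP; apply: ext_dot_nondegenerate => M.
  rewrite (ext_basis_sum M) ext_dotC ext_dot_sumr rmorph_sum big1 // => A _ /=.
  rewrite ext_dotZr ext_dotC -scaleN1r addrC ext_dotPr mulN1r ext_dot_sumr.
  rewrite (bigD1 A) //= big1 => [|B /negPf BA].
    rewrite ext_dotZr [ext_dot _ _ (H A)]ext_dotC HE eqxx rmorph1 mulr1 addr0.
    by rewrite addNr rmorph0 mulr0 rmorph0.
  by rewrite ext_dotZr [ext_dot _ _ (H B)]ext_dotC HE BA rmorph0 mulr0.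
rewrite {2}LE ext_dotC {1}LE.
rewrite ext_dot_sumr rmorph_sum /=.
suff -> (c : {set 'I_n} -> K) : f (\sum_A c A *: H A) = \sum_A theta (c A) * f (H A).
  apply: eq_bigr => A _; rewrite ext_dotZr rmorphM /= -ext_dotC; congr (_ * _).
  rewrite -ext_dotC ext_dot_sumr (bigD1 A) //= big1 => [|B /negPf BA].
    by rewrite ext_dotZr HE eqxx mulr1 addr0.
  by rewrite ext_dotZr HE eq_sym BA mulr0.
elim: (index_enum _) => [|A r IHr]; first by rewrite !big_nil f0.
by rewrite !big_cons f_lin IHr.
Qed.

(* M _| N, the unique P such that <L, P> = <M /\ L, N> for all L; see [contrP] *)
Definition contr M N : E :=
  classical_sets.xget 0 (fun P => forall L, ext_dot g L P = ext_dot g (M * L) N).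

Lemma contrP M N L : ext_dot g L (contr M N) = ext_dot g (M * L) N.
Proof.
rewrite /contr; case: classical_sets.xgetP => [P _ /(_ L) // | noP].
have [|P PE] := @ext_dot_riesz (fun L => ext_dot g (M * L) N).
  by move=> a L1 L2; rewrite mulrDr -scalerAr ext_dotPl.
by case: (noP P).
Qed.

Lemma contr_unique M N P :
  (forall L, ext_dot g L P = ext_dot g (M * L) N) -> P = contr M N.
Proof.
move=> PE; apply/eqP; rewrite -subr_eq0; apply/eqP.
apply: ext_dot_nondegenerate => L.
by rewrite -scaleN1r addrC ext_dotPr contrP PE mulN1r addNr.
Qed.

End Contraction.

Section Blades.
Variables (K : numFieldType) (theta : involutive_rmorphism K) (X : vectType K).
Variable g : {dot X for theta}.
Local Notation E := (exterior X).
Implicit Types (M N B : E) (u v w : X) (s : seq X) (U V : {vspace X}).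

Definition inner_space M : {vspace X} := lker (amulr M \o linfun (@vec K X)).

Lemma mem_inner_space M v : (v \in inner_space M) = (vec v * M == 0).
Proof. by rewrite memv_ker comp_lfunE !lfunE. Qed.

(* membership in the orthogonal complement of {w | w _| M = 0} *)
Definition outer_space M v : Prop :=
  forall w, contr g (vec w) M = 0 -> g v w = 0.

(* the subalgebra of the exterior algebra of X generated by V *)
Definition sub_exterior V : {vspace E} := agenv (linfun (@vec K X) @: V).

Inductive blade_span : E -> {vspace X} -> Prop :=
| scalar_blade (c : K) : blade_span c%:A 0%VS
| vector_blade v s : blade_span (ext_prod (v :: s)) <<v :: s>>%VS.

Definition blade B : Prop := exists U, blade_span B U.

(* [B]; meaningful for nonzero blades, see [blade_spaceE] *)
Definition blade_space B : {vspace X} :=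
  classical_sets.xget 0%VS (fun U => blade_span B U).

Lemma vec_eq0 v : (vec v == 0) = (v == 0).
Proof.
apply/eqP/eqP => [v0|->]; last by rewrite linear0.
apply/eqP; apply: contra_eqT v0 => v0.
have := @ext_prod_free _ _ _ g [:: v]; rewrite /ext_prod big_seq1; apply.
by rewrite seq1_free.
Qed.

Lemma mem_blade_span B U v :
  B != 0 -> blade_span B U -> (v \in U) = (vec v * B == 0).
Proof.
move=> B0 BU; case: BU B0 => [c|u s] B0.
  rewrite -scalerAr mulr1 scaler_eq0 vec_eq0 memv0.
  by case: (eqVneq c 0) B0 => // ->; rewrite scale0r eqxx.
apply/idP/idP => [/ext_prod_span -> //|]; apply: contraTT => v_us.
have -> : vec v * ext_prod (u :: s) = ext_prod [:: v, u & s].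
  by rewrite /ext_prod [RHS]big_cons.
by apply: (ext_prod_free g); rewrite free_cons v_us ext_prod_neq0_free.
Qed.

Lemma blade_spaceE B U : B != 0 -> blade_span B U -> blade_space B = U.
Proof.
move=> B0 BU; rewrite /blade_space; case: classical_sets.xgetP => [W _ BW|noU].
  by apply/vspaceP => v; rewrite (mem_blade_span _ B0 BW) (mem_blade_span _ B0 BU).
by case: (noU U).
Qed.

Definition blade_factorization M B N : Prop := [/\ blade B, B != 0 & M = B * N].

Definition tight B N : Prop :=
  forall v, outer_space N v -> v \in blade_space B -> v = 0.

Definition maximal M B : Prop := blade_space B = inner_space M.

Definition exists_unique_up_to_scalars (P : E -> E -> Prop) : Prop :=
  (exists B N, P B N) /\
  (forall B N B' N', P B N -> P B' N' ->
     exists2 lambda : K, lambda != 0 & B' = lambda *: B /\ N' = lambda^-1 *: N).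

End Blades.

Variant scalar_kind := Real | Complex.

Definition scalar_field (R : realType) (k : scalar_kind) : numFieldType :=
  match k with Real => R | Complex => R[i] end.

Definition scalar_conj (R : realType) (k : scalar_kind) :
    involutive_rmorphism (scalar_field R k) :=
  match k with
  | Real => idfun : involutive_rmorphism (scalar_field R Real)
  | Complex => Num.conj : involutive_rmorphism (R[i])
  end.
Arguments scalar_conj R k : clear implicits.

(* Main.v *)
(* Write S(W) for the subalgebra generated by W. Every element of S(<u> + W) is
   P + u /\ Q with P, Q in S(W), and for u outside W, u /\ P = 0 forces P = 0. So
   an element killed by u is u /\ Q, and peeling off a basis of the inner space U
   of M one vector at a time gives M = B /\ N with N in S(V). It is tight because
   the outer space of N lies in V: any w orthogonal to V contracts N to 0. For
   uniqueness, the same division, with V = 0, shows that nonzero blades with space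
   U are proportional, and B /\ _ is injective on S(V). *)
Require Import Defs.
From HB Require Import structures.
From mathcomp Require Import all_boot all_order all_algebra falgebra reals.

Set Implicit Arguments.
Unset Strict Implicit.
Unset Printing Implicit Defensive.
Local Open Scope ring_scope.

Import GRing.Theory.

(** * Moving a vector past elements of the exterior algebra *)

Section ExtProd.
Variables (K : fieldType) (X : vectType K).
Local Notation E := (exterior X).
Implicit Types (M : E) (u w : X) (s t : seq X).

Lemma ext_prod_nil : ext_prod [::] = 1 :> E.
Proof. exact: big_nil. Qed.

Lemma ext_prod_cons u s : ext_prod (u :: s) = vec u * ext_prod s.
Proof. exact: big_cons. Qed.

Lemma ext_prod_cat s t : ext_prod (s ++ t) = ext_prod s * ext_prod t.
Proof. exact: big_cat. Qed.

Lemma ext_prod_vecC s w :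
  ext_prod s * vec w = (-1) ^+ size s *: (vec w * ext_prod s).
Proof.
elim: s => [|u s IHs] /=; first by rewrite ext_prod_nil scale1r mulr1 mul1r.
rewrite ext_prod_cons -mulrA IHs -scalerAr mulrA vecC mulNr -mulrA.
by rewrite exprS mulN1r scalerN scaleNr opprK.
Qed.

(** The witness is the grade involution of [M]: moving [w] past [ext_basis A] costs the sign
    [(-1) ^+ #|A|]. The same witness serves in [vec_mul_exists], as the sign is its own inverse. *)
Lemma mul_vec_exists w M : exists N, M * vec w = vec w * N.
Proof.
exists (\sum_(A : {set 'I_(\dim {:X})}) (-1) ^+ #|A| *: (M A *: ext_basis A)).
rewrite {1}[M]ext_basis_sum mulr_suml mulr_sumr; apply: eq_bigr => A _.
rewrite -!scalerAr -scalerAl -ext_prod_basis ext_prod_vecC size_map -cardE.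
by rewrite !scalerA mulrC.
Qed.

Lemma vec_mul_exists w M : exists N, vec w * M = N * vec w.
Proof.
exists (\sum_(A : {set 'I_(\dim {:X})}) (-1) ^+ #|A| *: (M A *: ext_basis A)).
rewrite {1}[M]ext_basis_sum mulr_sumr [RHS]mulr_suml; apply: eq_bigr => A _.
rewrite -!scalerAl -scalerAr -ext_prod_basis ext_prod_vecC size_map -cardE.
by rewrite !scalerA mulrAC -expr2 sqrr_sign mul1r.
Qed.

Lemma ext_prod_mul_exists s M : exists N, ext_prod s * M = N * ext_prod s.
Proof.
elim: s M => [|u s IHs] M; first by exists M; rewrite ext_prod_nil mul1r mulr1.
have [N NE] := IHs M; have [P PE] := vec_mul_exists u N; exists P.
by rewrite ext_prod_cons -mulrA NE mulrA PE mulrA.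
Qed.

Lemma vec_mul_vec0 w M : vec w * M * vec w = 0.
Proof.
by have [N NE] := mul_vec_exists w M; rewrite -mulrA NE mulrA vec_sq mul0r.
Qed.

End ExtProd.

(** * The subalgebra generated by a subspace *)

Section SubExterior.
Variables (K : numFieldType) (X : vectType K).
Local Notation E := (exterior X).
Implicit Types (M N P Q : E) (u v w : X) (s t : seq X) (U V W : {vspace X}).

Lemma mem1_sub_exterior V : 1 \in sub_exterior V.
Proof. by rewrite memvE sub1_agenv. Qed.

Lemma vec_sub_exterior v V : v \in V -> vec v \in sub_exterior V.
Proof.
move=> vV; apply: (subvP (sub_agenv _)).
by rewrite -[vec v](lfunE (@vec K X)) memv_img.
Qed.

Lemma sub_exteriorM V M N :
  M \in sub_exterior V -> N \in sub_exterior V -> M * N \in sub_exterior V.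
Proof. by move=> MV NV; rewrite /sub_exterior -agenvM memv_mul. Qed.

Lemma ext_prod_sub_exterior s V : {subset s <= V} -> ext_prod s \in sub_exterior V.
Proof.
elim: s => [|u s IHs] sV; first by rewrite ext_prod_nil mem1_sub_exterior.
rewrite ext_prod_cons sub_exteriorM ?vec_sub_exterior ?sV ?mem_head //.
by apply: IHs => v vs; rewrite sV // inE vs orbT.
Qed.

Lemma mem_sub_exterior_fullv M : M \in sub_exterior fullv.
Proof.
rewrite [M]ext_basis_sum; apply: memv_suml => A _; apply: memvZ.
by rewrite -ext_prod_basis; apply: ext_prod_sub_exterior => v _; apply: memvf.
Qed.

Lemma sub_exterior_subv V (T : {vspace E}) :
  1 \in T -> (forall v M, v \in V -> M \in T -> vec v * M \in T) ->
  (sub_exterior V <= T)%VS.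
Proof.
move=> T1 TM; apply: agenv_sub_modl; first by rewrite -memvE.
apply/prodvP => _ M /memv_imgP[v vV ->] MT.
by rewrite lfunE TM.
Qed.

Lemma sub_exterior0 : (sub_exterior (0 : {vspace X}) <= 1)%VS.
Proof.
apply: sub_exterior_subv; first exact: memv_line.
by move=> v M; rewrite memv0 => /eqP -> _; rewrite linear0 mul0r mem0v.
Qed.

Lemma sub_exterior_ind V (T : {vspace E}) :
  (forall t, {subset t <= V} -> ext_prod t \in T) -> (sub_exterior V <= T)%VS.
Proof.
move=> tT; apply/subv_sumP => i _; apply/subvP => M.
(* A prefix [t] is carried along: the induction on the power takes a vector off the left of the
   product and appends it to [t]. The empty prefix gives the claim. *)
suff: forall t, {subset t <= V} ->
    ((linfun (@vec K X) @: V) ^+ i <= amull (ext_prod t) @^-1: T)%VS.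
  move=> sub Mi; have /sub/subvP/(_ M Mi) : {subset [::] <= V} by [].
  by rewrite -memv_preim lfunE /= ext_prod_nil mul1r.
elim: (val i) => [|m IHm] t tV.
  by rewrite expv0 -memvE -memv_preim lfunE /= mulr1 tT.
rewrite expvSl; apply/prodvP => _ N /memv_imgP[v vV ->] Nm.
have tvV : {subset rcons t v <= V}.
  by move=> x; rewrite mem_rcons inE => /predU1P[->|/tV].
have /subvP/(_ N Nm) := IHm _ tvV.
rewrite -!memv_preim !lfunE /= -cats1 ext_prod_cat.
by rewrite ext_prod_cons ext_prod_nil mulr1 mulrA.
Qed.

Lemma sub_exterior_add_line u W M :
  M \in sub_exterior (<[u]> + W) ->
  exists2 P, P \in sub_exterior W & exists2 Q, Q \in sub_exterior W &
    M = P + vec u * Q.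
Proof.
set T := (sub_exterior W + amull (vec u) @: sub_exterior W)%VS.
suff /subvP sub : (sub_exterior (<[u]> + W) <= T)%VS.
  move=> /sub /memv_addP[P PW [_ /memv_imgP[Q QW ->] ->]].
  by exists P => //; exists Q; rewrite // lfunE.
apply: sub_exterior_subv.
  by apply: (subvP (addvSl _ _)); rewrite mem1_sub_exterior.
move=> x M' /memv_addP[_ /vlineP[a ->] [w wW {x}->]].
move=> /memv_addP[P PW [_ /memv_imgP[Q QW ->] {M'}->]]; rewrite lfunE /=.
(* Since [u] squares to zero and anticommutes with [w], the product has the same shape, with new
   components [vec w * P] and [a *: P - vec w * Q]. *)
have -> : vec (a *: u + w) * (P + vec u * Q) =
    vec w * P + amull (vec u) (a *: P - vec w * Q).
  rewrite linearP /= lfunE /= mulrDl mulrBr -scalerAl -scalerAr !mulrDr.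
  rewrite scalerDr (mulrA (vec u) (vec u)) vec_sq mul0r scaler0 addr0.
  by rewrite (mulrA (vec w)) vecC mulNr -mulrA addrCA.
have vW N : N \in sub_exterior W -> vec w * N \in sub_exterior W.
  by apply: sub_exteriorM; apply: vec_sub_exterior.
by rewrite memv_add ?memv_img ?memvB ?memvZ ?vW.
Qed.

(* This gives cancellation: if u /\ M = 0, then moving u past Q yields
   u /\ ext_prod s = 0, which fails when u :: s is free. *)
Lemma sub_exterior_divides s M :
  M \in sub_exterior <<s>> -> M != 0 -> exists Q, Q * M = ext_prod s.
Proof.
elim: s M => [|u s IHs] M.
  rewrite span_nil => /(subvP sub_exterior0)/vlineP[a ->] aM0.
  have a0 : a != 0 by apply: contraNneq aM0 => ->; rewrite scale0r.
  exists (a^-1 *: 1).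
  by rewrite -scalerAl mul1r scalerA mulVf // scale1r ext_prod_nil.
rewrite span_cons => /sub_exterior_add_line[P Ps [N Ns ->]].
have [->|P0] := eqVneq P 0; last first.
  (* Multiplying by [vec u * Q] kills the term [vec u * N], where [u] then occurs twice. *)
  move=> _; have [Q QE] := IHs _ Ps P0; exists (vec u * Q).
  rewrite mulrDr [X in _ + X]mulrA vec_mul_vec0 mul0r addr0.
  by rewrite -mulrA QE ext_prod_cons.
rewrite add0r => uN0.
have N0 : N != 0 by apply: contraNneq uN0 => ->; rewrite mulr0.
have [Q QE] := IHs _ Ns N0; have [Q' Q'E] := vec_mul_exists u Q; exists Q'.
by rewrite mulrA -Q'E -mulrA QE ext_prod_cons.
Qed.

End SubExterior.

(** * Cancelling and dividing out products of independent vectors *)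

Section Factorization.
Variables (K : numFieldType) (theta : involutive_rmorphism K) (X : vectType K).
Variable g : {dot X for theta}.
Local Notation E := (exterior X).
Implicit Types (B M N P Q : E) (u v w : X) (s t : seq X) (U V W : {vspace X}).

(** If [P] were nonzero, some [Q * P] would be the product of a basis of [W]. Moving [ext_prod s] to
    the right past [Q] makes the nonzero product of [s ++ vbasis W] a multiple of [ext_prod s * P],
    which is zero. *)
Lemma ext_prod_mulI s W P :
  free (s ++ vbasis W) -> P \in sub_exterior W -> ext_prod s * P = 0 -> P = 0.
Proof.
move=> free_sW PW sP0; apply/eqP; apply: contraT => P0.
have [|Q QE] := @sub_exterior_divides _ _ (vbasis W) P _ P0.
  by rewrite (span_basis (vbasisP W)).
have /eqP[] := ext_prod_free g free_sW.
have [N NE] := ext_prod_mul_exists s Q.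
by rewrite ext_prod_cat -QE mulrA NE -mulrA sP0 mulr0.
Qed.

Lemma ext_prod_factor s W M :
  free (s ++ vbasis W) -> M \in sub_exterior (<<s>> + W) ->
  (forall u, u \in s -> vec u * M = 0) ->
  exists2 N, N \in sub_exterior W & M = ext_prod s * N.
Proof.
elim: s M => [|u s IHs] M /=.
  by rewrite span_nil add0v => _ MW _; exists M; rewrite // ext_prod_nil mul1r.
rewrite free_cons span_cat (span_basis (vbasisP W)) => /andP[u_sW free_sW].
rewrite span_cons -addvA => /sub_exterior_add_line[P PsW [Q QsW ->]] sM0.
have cancel_u N : N \in sub_exterior (<<s>> + W) -> vec u * N = 0 -> N = 0.
  move=> NsW uN0; apply: (@ext_prod_mulI [:: u] _ N _ NsW).
    rewrite /= free_cons (span_basis (vbasisP _)) u_sW.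
    exact: basis_free (vbasisP _).
  by rewrite ext_prod_cons ext_prod_nil mulr1.
have P0 : P = 0.
  apply: cancel_u => //; have := sM0 u (mem_head _ _).
  by rewrite mulrDr mulrA vec_sq mul0r addr0.
rewrite {}P0 add0r {P PsW} in sM0 *.
have [v vs|N NW ->] := IHs Q free_sW QsW; last first.
  by exists N; rewrite // ext_prod_cons mulrA.
(* To apply the induction hypothesis to [Q], each [v] in [s] must kill it. As [v] kills [vec u * Q],
   anticommutation gives that [u] kills [vec v * Q], and [u] can be cancelled. *)
apply: cancel_u.
  apply: sub_exteriorM => //; apply: vec_sub_exterior.
  by apply: (subvP (addvSl _ _)); rewrite memv_span.
by rewrite mulrA vecC mulNr -mulrA sM0 ?oppr0 // inE vs orbT.
Qed.

Lemma blade_sub_exterior B U : blade_span B U -> B \in sub_exterior U.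
Proof.
case=> [c|v s]; first by rewrite memvZ ?mem1_sub_exterior.
exact/ext_prod_sub_exterior/memv_span.
Qed.

Lemma blade_span_ext_prod s : blade_span (ext_prod s) <<s>>.
Proof.
case: s => [|v s]; last by constructor.
by rewrite span_nil ext_prod_nil -[1]scale1r; constructor.
Qed.

Lemma blade_eq_ext_prod B s :
  free s -> B != 0 -> blade_span B <<s>> ->
  exists2 c : K, c != 0 & B = c *: ext_prod s.
Proof.
move=> free_s B0 Bs; have [||u us|N] := @ext_prod_factor s 0%VS B.
- rewrite cat_free free_s (basis_free (vbasisP _)) (span_basis (vbasisP _)).
  by rewrite directv_addE /= capv0 eqxx !directv_trivial.
- by rewrite addv0 blade_sub_exterior.
- by apply/eqP; rewrite -(mem_blade_span g u B0 Bs) memv_span.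
move=> /(subvP (sub_exterior0 X))/vlineP[c ->]; rewrite -scalerAr mulr1 => BE.
by exists c => //; apply: contraNneq B0 => c0; rewrite BE c0 scale0r.
Qed.

(** * Orthogonality and outer spaces *)

Lemma contr_vec_sub_exterior w V N :
  {in V, forall v, g v w = 0} -> N \in sub_exterior V -> contr g (vec w) N = 0.
Proof.
move=> wV NV; apply: (@ext_dot_nondegenerate _ _ _ g) => L; rewrite contrP.
pose f : E -> K^o := ext_dot g (vec w * L).
suff /subvP/(_ _ NV) : (sub_exterior V <= lker (linfun f))%VS.
  by rewrite memv_ker lfunE => /eqP.
apply: sub_exterior_ind => t tV; rewrite memv_ker lfunE /= /f; apply/eqP.
rewrite ext_dotC [L]ext_basis_sum mulr_sumr ext_dot_sumr rmorph_sum big1 //= => A _.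
rewrite -scalerAr ext_dotZr rmorphM /= -ext_dotC -ext_prod_basis -ext_prod_cons.
(* For unequal lengths the product is zero by definition; otherwise row 0 of the Gram matrix pairs
   [w] with vectors of [V], so it vanishes. *)
rewrite ext_dot_prod /gram_det; case: eqP => [st|_]; last by rewrite mulr0.
rewrite (expand_det_row _ ord0) big1 ?mulr0 // => j _; rewrite mxE wV ?mul0r //.
by rewrite tV // mem_nth // -st.
Qed.

Lemma dot_eq0C u v : g u v = 0 -> g v u = 0.
Proof.
move=> /(congr1 theta) uv0.
by apply: etrans (hermC g v u) _; rewrite mul1r; apply: etrans uv0 (rmorph0 _).
Qed.

(** This is the inclusion of the double orthogonal of [V] in [V]. The proof builds the orthogonal
    projection [y] of [v] on [V]; then [v - y] is orthogonal to [v] and to [y], hence to itself. *)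
Lemma mem_of_orthogonal V v :
  (forall w, {in V, forall x, g x w = 0} -> g v w = 0) -> v \in V.
Proof.
move=> vV; pose f w : 'rV[K]_(\dim V) := \row_i g w (vbasis V)`_i.
have f_lin : linear f by move=> a x y; apply/rowP => i; rewrite !mxE linearPl.
pose fL : {linear X -> 'rV[K]_(\dim V)} :=
  HB.pack f (GRing.isLinear.Build _ _ _ _ f f_lin).
have f0P x : fL x = 0 -> {in V, forall y, g y x = 0}.
  move=> fx0 y /coord_vbasis ->; rewrite linear_sumlz big1 // => i _.
  have gx0 : g x (vbasis V)`_i = 0.
    by have /rowP/(_ i) : f x = 0 := fx0; rewrite !mxE.
  by rewrite linearZl_LR /= (dot_eq0C gx0) mulr0.
have Vker : (V :&: lker (linfun fL) = 0)%VS.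
  apply/eqP; rewrite -subv0; apply/subvP => x; rewrite memv_cap memv_ker lfunE memv0.
  by case/andP => xV /eqP/f0P/(_ x xV)/dot_eq0 ->.
(* [fL] is injective on [V], and its target has dimension [\dim V]. *)
have imV : (linfun fL @: V)%VS = fullv.
  by apply/eqP; rewrite eqEdim subvf (limg_dim_eq Vker) dimvf /dim /= mul1n.
have : linfun fL v \in (linfun fL @: V)%VS by rewrite imV memvf.
case/memv_imgP => y yV; rewrite !lfunE => fvy.
have vy_orth : {in V, forall x, g x (v - y) = 0}.
  by apply: f0P; rewrite linearB fvy subrr.
have : g (v - y) (v - y) = g v (v - y) - g y (v - y) by rewrite linearBl.
rewrite (vV _ vy_orth) (vy_orth y yV) subrr => /dot_eq0/eqP.
by rewrite subr_eq0 => /eqP ->.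
Qed.

Lemma outer_space_sub_exterior V N v :
  N \in sub_exterior V -> outer_space g N v -> v \in V.
Proof.
move=> NV Nv; apply: mem_of_orthogonal => w wV.
exact/Nv/(contr_vec_sub_exterior wV).
Qed.

(** An arbitrary involution [theta] covers the real and the complex case at once. *)
Theorem maximal_tight_factorization M V :
  (inner_space M + V)%VS = fullv -> (inner_space M :&: V)%VS = 0%VS ->
  exists_unique_up_to_scalars (fun B N : E =>
    [/\ blade_factorization M B N, maximal M B, tight g B N
      & N \in sub_exterior V]).
Proof.
set U := inner_space M => UV_full UV0.
set s := vbasis U; have sU : <<s>>%VS = U := span_basis (vbasisP U).
have free_s : free s := basis_free (vbasisP U).
have free_sV : free (s ++ vbasis V).
  rewrite cat_free free_s (basis_free (vbasisP _)) sU (span_basis (vbasisP _)).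
  by rewrite directv_addE /= UV0 eqxx !directv_trivial.
split.
  have [||u us|N NV ME] := @ext_prod_factor s V M; rewrite ?sU ?UV_full //.
  - exact: mem_sub_exterior_fullv.
  - by apply/eqP; rewrite -mem_inner_space -/U -sU memv_span.
  have s0 := ext_prod_free g free_s; have Bs := blade_span_ext_prod s.
  exists (ext_prod s), N; split=> //; first by split=> //; exists <<s>>%VS.
    by rewrite /maximal (blade_spaceE g s0 Bs).
  move=> v Nv; rewrite (blade_spaceE g s0 Bs) sU => vU.
  apply/eqP; rewrite -memv0 -UV0 memv_cap vU.
  exact: outer_space_sub_exterior Nv.
have ext_prod_multiple B N : blade_factorization M B N -> maximal M B ->
    exists2 c : K, c != 0 & B = c *: ext_prod s.
  move=> [[W BW] B0 _] BU; apply: blade_eq_ext_prod => //.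
  by rewrite sU /U -BU (blade_spaceE g B0 BW).
move=> B N B' N' [BN BU _ NV] [BN' BU' _ NV'].
have [c c0 BE] := ext_prod_multiple _ _ BN BU.
have [c' c'0 BE'] := ext_prod_multiple _ _ BN' BU'.
exists (c' / c); first by rewrite mulf_neq0 ?invr_eq0.
split; first by rewrite BE BE' scalerA divfK.
apply/eqP; rewrite -subr_eq0; apply/eqP.
(* It remains that [ext_prod s] kills the difference of [N'] and the rescaled [N]; after scaling by
   [c'] the product is [B' * N' - B * N], that is [M - M]. *)
apply: (ext_prod_mulI free_sV); first by rewrite memvB // memvZ.
apply: (scalerI c'0); rewrite scaler0 mulrBr scalerBr scalerAl -BE'.
rewrite -scalerAr scalerA invf_div mulrCA divff // mulr1 scalerAl -BE.
by case: BN BN' => _ _ <- [_ _ <-]; rewrite subrr.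
Qed.

End Factorization.

Theorem theorem3p16 (R : realType) (k : scalar_kind)
    (X : vectType (scalar_field R k)) (g : {dot X for scalar_conj R k})
    (M : exterior X) (V : {vspace X}) :
  (inner_space M + V)%VS = fullv ->
  (inner_space M :&: V)%VS = 0%VS ->
  exists_unique_up_to_scalars (fun B N : exterior X =>
    [/\ blade_factorization M B N, maximal M B, tight g B N
      & N \in sub_exterior V]).
Proof. exact: maximal_tight_factorization. Qed.
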